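(* Let $K$ be a field, let $m,n\ge 1$, let $X$ be an $m\times n$ matrix of indeterminates of one of the types specified below, let $Y=(y_1,\dots,y_n)^{T}$ be the generic $n\times 1$ column matrix, let $R$ be the polynomial algebra over $K$ in the indeterminates occurring in $X$ and $Y$, and let $g_1,\dots,g_m\in R$ be the entries of $XY$. For $1\le t\le m$ put $\mathcal{I}_t=\langle g_1,\dots,g_t\rangle\subseteq R$. (1) Let $m=n$ and let $X=(x_{ij})$ be generic or generic symmetric. Then: (i) $g_1,\dots,g_n$ is a regular sequence in $R$. (ii) For every $1\le t\le n-1$, the ideal $\mathcal{I}_t$ is a prime ideal in $R$. (iii) The primary decomposition of the ideal $\mathcal{I}_n=I_1(XY)$ is given by $$\mathcal{I}_n=\langle y_1,\dots,y_n\rangle\cap\langle g_1,\dots,g_n,\Delta\rangle,$$ where $\Delta$ denotes the determinant of $X$ (that is, the equality holds and the two ideals on the right are primary). (2) Let $m=n+1$ and let $X=(x_{ij})$ be generic. The primary decomposition of the ideal $\mathcal{I}_{n+1}=I_1(XY)$ is given by $$\mathcal{I}_{n+1}=\langle y_1,\dots,y_n\rangle\cap\langle g_1,\dots,g_{n+1},\Delta_1,\dots,\Delta_{n+1}\rangle,$$ where $\Delta_i$ denotes the determinant of the $n\times n$ matrix formed by removing the $i$-th row of $X$ (that is, the equality holds and the two ideals on the right are primary).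
   Context: ''Generic'' means that the entries $x_{ij}$ ($1\le i\le m$, $1\le j\le n$) of $X$ are distinct indeterminates over $K$. ''Generic symmetric'' (for $m=n$) means that $x_{ij}=x_{ji}$ and the $x_{ij}$ with $i\le j$ are distinct indeterminates. The $y_j$ are further distinct indeterminates. Thus $g_i=\sum_{j=1}^n x_{ij}y_j$. $I_1(XY)=\langle g_1,\dots,g_m\rangle$ is the ideal of $R$ generated by the entries of the $m\times 1$ matrix $XY$. *)

(* Defs.v *)
From mathcomp Require Import all_boot all_order all_algebra.
From mathcomp Require Import boolp mpoly.

Set Implicit Arguments.
Unset Strict Implicit.
Unset Printing Implicit Defensive.

Import GRing.Theory.
Local Open Scope ring_scope.

Section Ideals.
Variable R : comNzRingType.
Implicit Types (s : seq R) (S : {pred R}).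

(* Membership is made boolean with classical logic, so that the ideal
   predicates of ring_quotient apply. *)
Definition ideal_gen s : {pred R} :=
  [pred p | `[< exists c : 'I_(size s) -> R, p = \sum_i c i * s`_i >]].

(* [idealr_closed] already requires the ideal to be proper. *)
Definition prime_ideal S : Prop := idealr_closed S /\ prime_idealr_closed S.

Definition primary_ideal S : Prop :=
  idealr_closed S /\
  (forall u v, u * v \in S -> u \in S \/ exists k : nat, v ^+ k \in S).

(* Each s`_i is a nonzerodivisor modulo its predecessors, and s does not
   generate the unit ideal. *)
Definition regular_sequence s : Prop :=
  (forall i, (i < size s)%N -> forall p,
     s`_i * p \in ideal_gen (take i s) -> p \in ideal_gen (take i s)) /\
  1 \notin ideal_gen s.

End Ideals.

(* The polynomial ring over K in indeterminates x_a (a : I) and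
   y_0, ..., y_(n-1). *)
Notation xyring K I n := {mpoly K[#|{: I + 'I_n}|]}.

Section Indeterminates.
Variables (K : fieldType) (I : finType) (n : nat).

Definition xvar (a : I) : xyring K I n := 'X_(enum_rank (inl a : I + 'I_n)).
Definition yvar (j : 'I_n) : xyring K I n := 'X_(enum_rank (inr j : I + 'I_n)).
Definition ycol : 'cV[xyring K I n]_n := \col_j yvar j.

End Indeterminates.

Definition gen_index (m n : nat) : finType := ('I_m * 'I_n)%type.

Definition gen_mx (K : fieldType) (m n : nat) :
    'M[xyring K (gen_index m n) n]_(m, n) :=
  \matrix_(i, j) xvar K n ((i, j) : gen_index m n).

Definition sym_index (n : nat) : finType :=
  {p : 'I_n * 'I_n | (p.1 <= p.2)%N}.

Definition sort_pair (n : nat) (i j : 'I_n) : 'I_n * 'I_n :=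
  if (i <= j)%N then (i, j) else (j, i).

Lemma sort_pairP (n : nat) (i j : 'I_n) :
  ((sort_pair i j).1 <= (sort_pair i j).2)%N.
Proof. by rewrite /sort_pair; case: (leqP i j) => // /ltnW. Qed.

Definition sym_mx (K : fieldType) (n : nat) :
    'M[xyring K (sym_index n) n]_n :=
  \matrix_(i, j) xvar K n (exist _ (sort_pair i j) (sort_pairP i j) : sym_index n).

Definition entries (R : comNzRingType) (m : nat) (v : 'cV[R]_m) : seq R :=
  [seq v i 0 | i : 'I_m].

(* Main.v *)
From HB Require Import structures.
Require Import Defs.
From mathcomp Require Import all_boot all_order all_algebra.
From mathcomp Require Import boolp mpoly.
From mathcomp Require Import ring.

(** The proof compares two families of ideals, indexed by a number k of columns
    and a number t of rows.  J(k,t) is generated by the y_j with j >= k and by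
    the first t entries of X Y; up to those y_j, the entries are linear forms in
    y_0, ..., y_(k-1) only.  Q(k,t) adds to J(k,t) the k x k minors of the first
    t rows and first k columns of X.  With n columns, J(n,t) is the ideal of the
    first t entries of X Y, there are no minors when t < n, and for t = n or
    t = n + 1 the minors are Delta or the Delta_i.  Writing P for the ideal of
    all the y_j, it suffices to prove two things for every t:
    J(n,t) is the intersection of P and Q(n,t), and Q(n,t) is prime.  The proof
    of the latter also shows that the next entry of X Y is a nonzerodivisor
    modulo Q(n,t), which for t < n is the regularity of the sequence.

    The intersection formula ([minor_ideal_cap_y]) holds because Cramer's rule
    puts the product of a minor and any y_j in J(k,t), while the retraction of
    the polynomial ring that sends all y_j to 0 has kernel P and fixes the
    minors.

    For primality, let c = k - 1.  Once y_c is inverted, the t linear forms can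
    be solved for the variables x_(i,c), so the saturation of J(k,t) with
    respect to y_c is the kernel of a homomorphism phi to the fraction field of
    the polynomial ring ([phi_form], [phi_ker]).  It contains Q(k,t), again by
    Cramer's rule, and it does not contain the next form ([form_notin]).  Hence
    as soon as y_c is a nonzerodivisor modulo Q(k,t), this ideal is the kernel
    of phi, it is prime, and the next form is a nonzerodivisor modulo it.

    That y_k is a nonzerodivisor modulo Q(k+1,t) is an induction on k and t
    ([y_nonzerodivisor_rowS]).  If y_k p lies in Q(k+1,t+1), it lies in
    J(k+1,t+1) by the intersection formula, so y_k p = a g_t modulo J(k+1,t).
    Modulo y_k this says that a g_t is in J(k,t), so a is in Q(k,t) by the
    result for k columns.  Expanding a (k+1) x (k+1) minor along its last column
    shows that (k x k minor) g_t = y_k ((k+1) x (k+1) minor) modulo J(k+1,t);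
    therefore a g_t = y_k w modulo J(k+1,t) for some w in Q(k+1,t+1), and p - w
    is in Q(k+1,t) by induction on t.

    Generic and generic symmetric matrices are treated together: the argument
    only asks that the variables in a column be distinct, and that the entries
    to the left of a column do not involve its variables, except possibly in the
    row of the diagonal entry, where only the diagonal variable is excluded. *)

Set Implicit Arguments.
Unset Strict Implicit.
Unset Printing Implicit Defensive.

Import GRing.Theory.
Local Open Scope ring_scope.

(** * Ideals as closures of sets of generators *)

Section IdealSpan.
Variable R : comNzRingType.
Implicit Types (S T : R -> Prop) (p q a : R).

Definition is_ideal T :=
  [/\ T 0, forall p q, T p -> T q -> T (p + q) & forall a p, T p -> T (a * p)].

(** The smallest ideal containing [S].  The impredicative form gives inclusions
    between ideals by checking generators, also for infinite families such as
    all minors; the constructor stops views from unfolding it. *)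
Variant ideal_span S p : Prop :=
  IdealSpan of forall T, is_ideal T -> (forall s, S s -> T s) -> T p.

Lemma span_sub S T : is_ideal T -> (forall s, S s -> T s) ->
  forall p, ideal_span S p -> T p.
Proof. by move=> idT ST p [Sp]; apply: Sp. Qed.

Lemma span_ideal S : is_ideal (ideal_span S).
Proof.
split=> [|p q [Sp] [Sq]|a p [Sp]]; split=> T idT ST.
- by case: idT.
- by case: (idT) => _ D _; apply: D; [apply: Sp | apply: Sq].
- by case: (idT) => _ _ M; apply: M; apply: Sp.
Qed.

Lemma span_gen S p : S p -> ideal_span S p.
Proof. by move=> Sp; split=> T _; apply. Qed.

Lemma span0 S : ideal_span S 0.
Proof. by case: (span_ideal S). Qed.

Lemma spanD S p q : ideal_span S p -> ideal_span S q -> ideal_span S (p + q).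
Proof. by case: (span_ideal S) => _ + _; apply. Qed.

Lemma spanMl S a p : ideal_span S p -> ideal_span S (a * p).
Proof. by case: (span_ideal S) => _ _; apply. Qed.

Lemma spanMr S p a : ideal_span S p -> ideal_span S (p * a).
Proof. by rewrite mulrC; apply: spanMl. Qed.

Lemma spanN S p : ideal_span S p -> ideal_span S (- p).
Proof. by rewrite -mulN1r; apply: spanMl. Qed.

Lemma spanB S p q : ideal_span S p -> ideal_span S q -> ideal_span S (p - q).
Proof. by move=> Sp Sq; apply: spanD => //; apply: spanN. Qed.

Lemma span_sum S (I : Type) (r : seq I) (P : pred I) (F : I -> R) :
  (forall i, P i -> ideal_span S (F i)) ->
  ideal_span S (\sum_(i <- r | P i) F i).
Proof. by move=> SF; apply: big_ind => //; [apply: span0 | apply: spanD]. Qed.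

Lemma span_congr S p q :
  ideal_span S (p - q) -> ideal_span S q -> ideal_span S p.
Proof. by move=> Spq Sq; rewrite -(subrK q p); apply: spanD. Qed.

Lemma span_mono S S' : (forall s, S s -> ideal_span S' s) ->
  forall p, ideal_span S p -> ideal_span S' p.
Proof. exact: span_sub (span_ideal S'). Qed.

Lemma ker_ideal (F : comNzRingType) (f : {rmorphism R -> F}) :
  is_ideal (fun p => f p = 0).
Proof.
split=> [|p q fp fq|a p fp]; first by rewrite rmorph0.
  by rewrite rmorphD fp fq addr0.
by rewrite rmorphM fp mulr0.
Qed.

Lemma ideal_genE (s : seq R) p :
  reflect (ideal_span (fun q => q \in s) p) (p \in ideal_gen s).
Proof.
apply: (iffP (asboolP _)) => [[c ->] | ].
  by apply: span_sum => i _; apply/spanMl/span_gen/mem_nth.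
move: p; apply: span_sub => [|q /(nthP 0)[i ltis <-]].
  split=> [|u v [c ->] [d ->]|a u [c ->]].
  - by exists (fun=> 0); rewrite big1 // => i; rewrite mul0r.
  - by exists (fun i => c i + d i); rewrite -big_split; apply: eq_bigr => i;
      rewrite mulrDl.
  - by exists (fun i => a * c i); rewrite mulr_sumr; apply: eq_bigr => i;
      rewrite mulrA.
exists (fun j => (j == Ordinal ltis)%:R).
rewrite (bigD1 (Ordinal ltis)) //= eqxx mul1r big1 ?addr0 // => j /negPf ->.
by rewrite mul0r.
Qed.

Lemma prime_ideal_primary (S : {pred R}) : prime_ideal S -> primary_ideal S.
Proof.
case=> idS prS; split=> // u v uvS.
by case/orP: (prS _ _ uvS); [left | right; exists 1; rewrite expr1].
Qed.

Lemma ker_prime_ideal (F : idomainType) (f : {rmorphism R -> F})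
    (S : {pred R}) :
  (forall p, p \in S <-> f p = 0) -> prime_ideal S.
Proof.
move=> SE; split; first split.
- by apply/SE; rewrite rmorph0.
- by apply/negP => /SE/eqP; rewrite rmorph1 oner_eq0.
- move=> a u v /SE fu /SE fv; apply/SE.
  by rewrite rmorphD rmorphM fu fv mulr0 addr0.
move=> u v /SE/eqP; rewrite rmorphM mulf_eq0.
by case/orP=> /eqP/SE ->; rewrite ?orbT.
Qed.

End IdealSpan.

(** * Choices of rows *)

Section IncreasingMaps.
Implicit Types (f : nat -> nat) (k t : nat).

(** Strictly increasing choices of [k] rows among the first [t].  Plain
    functions on [nat], of which only the values below [k] matter, avoid casts
    between ordinal types when [k] varies. *)
Definition increasing k t f :=
  (forall a b, (a < b < k)%N -> (f a < f b)%N) /\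
  (forall a, (a < k)%N -> (f a < t)%N).

Definition extend k t f a := if (a < k)%N then f a else t.

Lemma extend_increasing k t f :
  increasing k t f -> increasing k.+1 t.+1 (extend k t f).
Proof.
case=> f_incr f_lt; rewrite /extend; split=> [a b /andP[ltab]|a _].
  rewrite ltnS leq_eqVlt => /orP[/eqP eb | ltbk].
    by rewrite -eb ltab ltnn f_lt // -eb.
  by rewrite ltbk (ltn_trans ltab ltbk) f_incr // ltab.
by case: ifP => [/f_lt|]; rewrite ltnS // => /ltnW.
Qed.

Lemma increasing_ge k t f a : increasing k t f -> (a < k)%N -> (a <= f a)%N.
Proof.
case=> f_incr _; elim: a => // a IHa lt_ak.
by apply: leq_ltn_trans (IHa (ltnW lt_ak)) (f_incr _ _ _); rewrite ltnSn.
Qed.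

Lemma increasing_le k d f a :
  increasing k (k + d) f -> (a < k)%N -> (f a <= a + d)%N.
Proof.
case=> f_incr f_lt lt_ak.
have [b eb] : exists b, (a + b).+1 = k.
  by exists (k - a.+1)%N; rewrite -addSn subnKC.
elim: b a eb lt_ak => [|b IHb] a eb lt_ak.
  by move: (f_lt a lt_ak); rewrite -eb addn0 addSn ltnS.
have lt_a1k : (a.+1 < k)%N by rewrite -eb addnS !ltnS leq_addr.
have := IHb a.+1 _ lt_a1k; rewrite addSnnS => /(_ eb) le1.
have /leq_trans/(_ le1) : (f a < f a.+1)%N by apply: f_incr; rewrite ltnSn.
by rewrite addSn ltnS.
Qed.

Lemma increasing_id k f a : increasing k k f -> (a < k)%N -> f a = a.
Proof.
move=> f_incr ltak; apply/eqP; rewrite eqn_leq (increasing_ge f_incr) // andbT.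
by rewrite -[leqRHS]addn0 (increasing_le (k := k)) ?addn0.
Qed.

Lemma bump_increasing k i : increasing k k.+1 (bump i).
Proof.
split=> [a b /andP[ltab _]|a ltak]; first by rewrite ltnNge leq_bump2 -ltnNge.
by rewrite ltnS /bump; case: (i <= a)%N => //; apply: ltnW.
Qed.

(** The omitted row is the first [a] with [f a != a], or [k] if there is none:
    before it [f] is the identity, from there on [a < f a <= a.+1]. *)
Lemma increasing_bump k f : increasing k k.+1 f ->
  exists i : 'I_k.+1, forall a, (a < k)%N -> f a = bump i a.
Proof.
move=> f_incr; pose s := find (fun a => f a != a) (iota 0 k).
have les : (s <= k)%N by rewrite -[leqRHS](size_iota 0 k) find_size.
exists (Ordinal (les : (s < k.+1)%N)) => a ltak; rewrite /bump /=.
case: (leqP s a) => [lesa|ltas]; last first.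
  by have := before_find 0 ltas; rewrite nth_iota // add0n => /negbFE/eqP.
apply/eqP; rewrite eqn_leq addnC (increasing_le _ ltak) ?addn1 //=.
elim: a lesa ltak => [|a IHa]; rewrite leq_eqVlt => /orP[/eqP es|lesa] // ltak.
- have := @nth_find _ 0 (fun a => f a != a) (iota 0 k).
  rewrite has_find size_iota -/s es nth_iota // => /(_ ltak).
  by rewrite add0n lt0n.
- have := @nth_find _ 0 (fun a => f a != a) (iota 0 k).
  rewrite has_find size_iota -/s es nth_iota // => /(_ ltak).
  by rewrite add0n ltn_neqAle eq_sym => ->; apply: increasing_ge f_incr ltak.
apply: leq_ltn_trans (IHa lesa (ltnW ltak)) _.
by case: f_incr => + _; apply; rewrite ltnSn.
Qed.

End IncreasingMaps.

(** * Linear forms, minors and Cramer's rule *)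

Section LinearForms.
Variables (R : comNzRingType) (x : nat -> nat -> R) (y : nat -> R) (n : nat).
Implicit Types (f : nat -> nat) (k t : nat).

(** The entry of index [i] of the product of the matrix and the column of the
    y_j, truncated to the first [k] columns. *)
Definition row_form k i : R := \sum_(j < k) x i j * y j.

Definition leading_mx k f : 'M[R]_k := \matrix_(a < k, j < k) x (f a) j.

Definition row_minor k f : R := \det (leading_mx k f).

Lemma mulmx_leading k f :
  leading_mx k f *m (\col_j y j) = \col_a row_form k (f a).
Proof.
apply/matrixP=> a j; rewrite !mxE /row_form.
by apply: eq_bigr => l _; rewrite !mxE.
Qed.

Lemma cramer k f (j : 'I_k) :
  \sum_(a < k) (\adj (leading_mx k f)) j a * row_form k (f a) =
  row_minor k f * y j.
Proof.
have := congr1 (mulmx (\adj (leading_mx k f))) (mulmx_leading k f).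
rewrite mulmxA mul_adj_mx mul_scalar_mx => /matrixP/(_ j ord0).
by rewrite !mxE => ->; apply: eq_bigr => a _; rewrite !mxE.
Qed.

(** The cofactor of the bottom right corner of a minor extended by one row and
    one column is the original minor; the corner makes the sign 1. *)
Lemma adj_extend k t f :
  (\adj (leading_mx k.+1 (extend k t f))) ord_max ord_max = row_minor k f.
Proof.
rewrite mxE /cofactor -signr_odd oddD addbb expr0 mul1r.
congr (\det _); apply/matrixP=> a j; rewrite !mxE /= /bump.
have le a0 : (k <= @nat_of_ord k a0)%N = false by rewrite leqNgt ltn_ord.
by rewrite !le !add0n /extend ltn_ord.
Qed.

(** The generators of J(k,t), and below those of Q(k,t).  With [y j] for
    [k <= j < n] among them, computing modulo these ideals replaces a
    ring with fewer variables in the induction on [k]. *)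
Definition form_gens k t p :=
  (exists2 j, (k <= j < n)%N & p = y j) \/
  (exists2 i, (i < t)%N & p = row_form n i).

Definition minor_gens k t p :=
  form_gens k t p \/ (exists2 f, increasing k t f & p = row_minor k f).

Definition form_ideal k t := ideal_span (form_gens k t).
Definition minor_ideal k t := ideal_span (minor_gens k t).

Lemma form_ideal_y k t j : (k <= j < n)%N -> form_ideal k t (y j).
Proof. by move=> jP; apply: span_gen; left; exists j. Qed.

Lemma form_ideal_form k t i : (i < t)%N -> form_ideal k t (row_form n i).
Proof. by move=> lti; apply: span_gen; right; exists i. Qed.

Lemma row_form_trunc k t i : (k <= n)%N ->
  form_ideal k t (row_form n i - row_form k i).
Proof.
move=> lekn; rewrite /row_form -!(big_mkord xpredT (fun j => x i j * y j)).
rewrite (big_cat_nat (n := k)) //= addrAC subrr add0r.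
rewrite big_nat_cond; apply: span_sum => j /andP[jP _].
by apply: spanMl; apply: form_ideal_y.
Qed.

Lemma form_ideal_trunc k t i : (k <= n)%N -> (i < t)%N ->
  form_ideal k t (row_form k i).
Proof.
move=> lekn ltit; rewrite -(subKr (row_form n i) (row_form k i)).
by apply: spanB; [apply: form_ideal_form | apply: row_form_trunc].
Qed.

Lemma form_ideal_sub_minor k t p : form_ideal k t p -> minor_ideal k t p.
Proof. by apply: span_mono => s Js; apply: span_gen; left. Qed.

Lemma form_ideal_mono k k' t t' p :
  (k' <= k)%N -> (t <= t')%N -> form_ideal k t p -> form_ideal k' t' p.
Proof.
move=> lek let'; apply: span_mono => s [[j /andP[lekj ltjn] ->]|[i ltit ->]].
  by apply: form_ideal_y; rewrite ltjn (leq_trans lek).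
by apply: form_ideal_form; apply: leq_trans ltit _.
Qed.

Lemma minor_idealS k t p : minor_ideal k t p -> minor_ideal k t.+1 p.
Proof.
apply: span_mono => s [Js|[f [f_incr f_lt] ->]].
  by apply/form_ideal_sub_minor/(form_ideal_mono (leqnn k) (leqnSn t))/span_gen.
by apply: span_gen; right; exists f => //; split=> // a /f_lt/leqW.
Qed.

(** There is no strictly increasing choice of [k] rows among fewer than [k]. *)
Lemma minor_ideal_lt k t p : (t < k)%N -> minor_ideal k t p -> form_ideal k t p.
Proof.
case: k => // k lttk; apply: span_mono => s [Js|[f f_incr _]].
  exact: span_gen.
have lekf := increasing_ge f_incr (ltnSn k).
by case: f_incr => _ /(_ k (ltnSn k)); rewrite ltnNge (leq_trans _ lekf).
Qed.

(** The empty minor is 1; this starts the induction on the number of columns. *)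
Lemma minor_ideal0 t p : minor_ideal 0 t p.
Proof.
rewrite -[p]mulr1; apply/spanMl/span_gen; right; exists id.
  by split=> // a b; rewrite andbF.
by rewrite /row_minor det_mx00.
Qed.

Lemma minor_mul_y k t f j : (k <= n)%N -> (j < n)%N -> increasing k t f ->
  form_ideal k t (row_minor k f * y j).
Proof.
move=> lekn ltjn [_ f_lt]; case: (ltnP j k) => [ltjk|lekj].
  rewrite -(cramer f (Ordinal ltjk)); apply: span_sum => a _.
  by apply: spanMl; apply: form_ideal_trunc => //; apply: f_lt.
by apply: spanMl; apply: form_ideal_y; rewrite lekj.
Qed.

(** Row [k] of Cramer's rule for the extended minor: all its terms but the last
    are multiples of forms already in the ideal, and the last cofactor is the
    original minor. *)
Lemma minor_extend k t f : (k < n)%N -> increasing k t f ->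
  form_ideal k.+1 t
    (row_minor k f * row_form n t - y k * row_minor k.+1 (extend k t f)).
Proof.
move=> ltkn [_ f_lt].
have /= := cramer (extend k t f) (@ord_max k).
have last_row : extend k t f k = t by rewrite /extend ltnn.
rewrite big_ord_recr adj_extend /= last_row => cr.
rewrite [y k * _]mulrC -cr opprD addrCA -mulrBr addrC.
apply: spanB; first by apply/spanMl/row_form_trunc.
apply: span_sum => a _; apply/spanMl/form_ideal_trunc => //.
by rewrite /extend ltn_ord f_lt.
Qed.

Lemma form_ideal_split k t p : form_ideal k t.+1 p ->
  exists a, form_ideal k t (p - a * row_form n t).
Proof.
move: p; apply: span_sub => [|s].
  split=> [|u v [a Ja] [b Jb]|c u [a Ja]].
  - by exists 0; rewrite mul0r subr0; apply: span0.
  - by exists (a + b); rewrite mulrDl opprD addrACA; apply: spanD.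
  - by exists (c * a); rewrite -mulrA -mulrBr; apply: spanMl.
case=> [[j jP ->]|[i]].
  by exists 0; rewrite mul0r subr0; apply: form_ideal_y.
rewrite ltnS leq_eqVlt => /orP[/eqP -> ->|ltit ->].
  by exists 1; rewrite mul1r subrr; apply: span0.
by exists 0; rewrite mul0r subr0; apply: form_ideal_form.
Qed.

(** Multiplying by the next form turns an element of the minor ideal for [k]
    columns into a multiple of [y k]: [y k] itself is lifted to the form, a
    minor to its extension, and the other generators to 0. *)
Lemma minor_ideal_lift k t a : (k < n)%N -> minor_ideal k t a ->
  exists2 w, minor_ideal k.+1 t.+1 w &
    form_ideal k.+1 t (a * row_form n t - y k * w).
Proof.
move=> ltkn.
have idw : is_ideal (fun a => exists2 w, minor_ideal k.+1 t.+1 w &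
   form_ideal k.+1 t (a * row_form n t - y k * w)).
  split=> [|u v [w Qw Jw] [w' Qw' Jw']|c u [w Qw Jw]].
  - by exists 0; rewrite ?mul0r ?mulr0 ?subr0; apply: span0.
  - exists (w + w'); first exact: spanD.
    by rewrite mulrDl mulrDr opprD addrACA; apply: spanD.
  - exists (c * w); first exact: spanMl.
    by rewrite mulrCA -mulrA -mulrBr; apply: spanMl.
have idJ s : form_ideal k.+1 t s -> exists2 w, minor_ideal k.+1 t.+1 w &
    form_ideal k.+1 t (s * row_form n t - y k * w).
  by move=> Js; exists 0; rewrite ?mulr0 ?subr0; [apply: span0 | apply: spanMr].
move: a; apply: span_sub => // s.
case=> [[[j /andP[lekj ltjn] ->]|[i ltit ->]]|[f f_incr ->]].
- move: lekj; rewrite leq_eqVlt => /orP[/eqP <-|ltkj].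
    exists (row_form n t); first by apply/form_ideal_sub_minor/form_ideal_form.
    by rewrite subrr; apply: span0.
  by apply/idJ/form_ideal_y; rewrite ltkj.
- exact/idJ/form_ideal_form.
exists (row_minor k.+1 (extend k t f)); last exact: minor_extend.
apply: span_gen; right; exists (extend k t f) => //.
exact: extend_increasing.
Qed.

(** [rho] models the substitution y = 0. *)
Section Retraction.
Variables (m : nat) (rho : {rmorphism R -> R}).
Hypothesis rho_y : forall j, (j < n)%N -> rho (y j) = 0.
Hypothesis rho_x : forall i j, (i < m)%N -> (j < n)%N -> rho (x i j) = x i j.
Hypothesis rho_id : forall p, form_ideal 0 0 (p - rho p).

Lemma retract_minor k f t : (t <= m)%N -> increasing k t f -> (k <= n)%N ->
  rho (row_minor k f) = row_minor k f.
Proof.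
move=> letm [_ f_lt] lekn; rewrite /row_minor -det_map_mx.
congr (\det _); apply/matrixP=> a j; rewrite !mxE rho_x //.
  by apply: leq_trans (f_lt a _) letm.
exact: leq_trans (ltn_ord j) lekn.
Qed.

Lemma retract_row_form i : rho (row_form n i) = 0.
Proof.
by rewrite rmorph_sum big1 // => j _; rewrite rmorphM rho_y ?mulr0.
Qed.

Lemma retract_form_ideal k t p : form_ideal k t p -> rho p = 0.
Proof.
move: p; apply: span_sub; first exact: ker_ideal.
move=> s [[j /andP[_ ltjn] ->]|[i _ ->]]; first exact: rho_y.
exact: retract_row_form.
Qed.

(** The elements p such that p - rho p and all y_j (rho p) are in the form ideal
    make up an ideal.  It contains the minors, which rho fixes, by Cramer's
    rule; and when rho p = 0 the first condition is the conclusion. *)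
Lemma minor_ideal_cap_y k t p : (k <= n)%N -> (t <= m)%N ->
  minor_ideal k t p -> rho p = 0 -> form_ideal k t p.
Proof.
move=> lekn letm Qp.
suff [Jp _] : form_ideal k t (p - rho p) /\
    forall j, (j < n)%N -> form_ideal k t (y j * rho p).
  by move=> rp; rewrite rp subr0 in Jp.
move: p Qp; apply: span_sub => [|s].
  split=> [|p q [Jp yp] [Jq yq]|a p [Jp yp]].
  - rewrite rmorph0 subrr; split=> [|j _]; first exact: span0.
    by rewrite mulr0; apply: span0.
  - split=> [|j ltjn]; first by rewrite rmorphD opprD addrACA; apply: spanD.
    by rewrite rmorphD mulrDr; apply: spanD; [apply: yp | apply: yq].
  - split=> [|j ltjn]; last by rewrite rmorphM mulrCA; apply/spanMl/yp.
    (* a - rho a is a combination of the y_j, and each y_j (rho p) is in the ideal *)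
    have -> : a * p - rho (a * p) = a * (p - rho p) + (a - rho a) * rho p.
      by rewrite rmorphM; ring.
    apply: spanD; first exact: spanMl.
    move: (a - rho a) (rho_id a).
    apply: span_sub => [|_ [[j /andP[_ ltj] ->]|[i //]]].
      split=> [|u v Ju Jv|b u Ju]; first by rewrite mul0r; apply: span0.
        by rewrite mulrDl; apply: spanD.
      by rewrite -mulrA; apply: spanMl.
    exact: yp.
case=> [Js|[f f_incr ->]].
  rewrite (retract_form_ideal (span_gen Js)) subr0.
  split=> [|j _]; first exact: span_gen.
  by rewrite mulr0; apply: span0.
rewrite (retract_minor letm f_incr) // subrr.
split=> [|j ltjn]; first exact: span0.
by rewrite mulrC; apply: minor_mul_y.
Qed.

(** The inductive step from [t] to [t.+1] rows.  The hypothesis on the form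
    comes from [k] columns, the one on [y k] from one row less. *)
Lemma y_nonzerodivisor_rowS k t : (k < n)%N -> (t < m)%N ->
  (forall p, minor_ideal k t (row_form n t * p) -> minor_ideal k t p) ->
  (forall p, minor_ideal k.+1 t (y k * p) -> minor_ideal k.+1 t p) ->
  forall p, minor_ideal k.+1 t.+1 (y k * p) -> minor_ideal k.+1 t.+1 p.
Proof.
move=> ltkn lttm form_reg y_reg p Qyp.
have Jyp : form_ideal k.+1 t.+1 (y k * p).
  by apply: minor_ideal_cap_y => //; rewrite rmorphM rho_y // mul0r.
have [a Ja] := form_ideal_split Jyp.
(* [y k] is a generator of the form ideal for [k] columns *)
have Qa : minor_ideal k t a.
  apply: form_reg; rewrite mulrC -(subKr (y k * p) (_ * _)); apply: spanB.
    by apply/form_ideal_sub_minor/spanMr/form_ideal_y; rewrite leqnn.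
  by apply/form_ideal_sub_minor/(form_ideal_mono (leqnSn k) (leqnn t)).
have [w Qw Jw] := minor_ideal_lift ltkn Qa.
apply: span_congr Qw; apply/minor_idealS/y_reg/form_ideal_sub_minor.
by rewrite mulrBr -(subrKA (a * row_form n t)); apply: spanD.
Qed.

End Retraction.
End LinearForms.

(** * Polynomial rings: elimination of a column of variables *)

Section GenericPolynomials.
Variables (K : fieldType) (N : nat).
Local Notation R := {mpoly K[N]}.
Implicit Types p q : R.

Lemma mpoly_var_ind (P : R -> Prop) :
  (forall c, P c%:MP) -> (forall i, P 'X_i) ->
  (forall p q, P p -> P q -> P (p + q)) ->
  (forall p q, P p -> P q -> P (p * q)) -> forall p, P p.
Proof.
move=> PC PX PD PM p; rewrite (mpolyE p).
apply: big_ind => [||mm _]; [exact: (PC 0) | exact: (PD) |].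
rewrite -mul_mpolyC; apply: (PM) => //; rewrite mpolyXE_id.
apply: big_ind => [||i _]; [exact: (PC 1) | exact: (PM) |].
elim: (mm i) => [|e IHe]; first by rewrite expr0; apply: (PC 1).
by rewrite exprS; apply: PM.
Qed.

(** [vx i j] and [vy j] index the variables at the entries of the matrix and of
    the column.  [vx_neq_col] leaves out [i = c], because in a symmetric matrix
    row [c] repeats variables of column [c]; [vx_neq_diag] is what remains
    there. *)
Variables (m n : nat) (vx : nat -> nat -> 'I_N) (vy : nat -> 'I_N).
Hypothesis vy_inj : forall j l, (j < n)%N -> (l < n)%N -> vy j = vy l -> j = l.
Hypothesis vx_neq_vy : forall i j l, (i < m)%N -> (j < n)%N -> (l < n)%N ->
  vx i j != vy l.
Hypothesis vx_col_inj : forall i i' c, (i < m)%N -> (i' < m)%N -> (c < n)%N ->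
  vx i c = vx i' c -> i = i'.
Hypothesis vx_neq_col : forall i i' l c, (i < m)%N -> (i' < m)%N -> (c < n)%N ->
  (l < c)%N -> i != c -> vx i l != vx i' c.
Hypothesis vx_neq_diag : forall l c, (c < m)%N -> (c < n)%N -> (l < c)%N ->
  vx c l != vx c c.

Definition xentry i j : R := 'X_(vx i j).
Definition yentry j : R := 'X_(vy j).

Local Notation x := xentry.
Local Notation y := yentry.

Lemma yentry_neq0 j : y j != 0.
Proof.
apply/eqP=> /(congr1 (mcoeff U_(vy j))); rewrite mcoeffXU eqxx mcoeff0.
by apply/eqP/oner_neq0.
Qed.

Local Notation form := (row_form x y).
Local Notation minor := (row_minor x).
Local Notation J := (form_ideal x y n).
Local Notation Q := (minor_ideal x y n).

(** The variables y_j with [k <= j], which vanish modulo the ideals for [k]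
    columns. *)
Definition late k v := [exists j : 'I_n, (k <= j)%N && (v == vy j)].

Lemma late_y k j : (j < n)%N -> late k (vy j) = (k <= j)%N.
Proof.
move=> ltjn; apply/existsP/idP => [[l /andP[lekl /eqP ejl]]|lekj].
  by rewrite (vy_inj ltjn (ltn_ord l) ejl).
by exists (Ordinal ltjn); rewrite lekj eqxx.
Qed.

Lemma late_x k i j : (i < m)%N -> (j < n)%N -> late k (vx i j) = false.
Proof.
move=> ltim ltjn; apply/existsP => -[l /andP[_]].
by rewrite (negPf (vx_neq_vy ltim ltjn (ltn_ord l))).
Qed.

Definition kill_late k v : R := if late k v then 0 else 'X_v.

Local Notation rho k := (mmap (@mpolyC N K) (kill_late k)).

Lemma kill_lateX k v : rho k 'X_v = kill_late k v.
Proof. by rewrite mmapX mmap1U. Qed.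

Lemma kill_late_id k p : J k 0 (p - rho k p).
Proof.
elim/mpoly_var_ind: p => [c|v|p q Jp Jq|p q Jp Jq].
- by rewrite mmapC subrr; apply: span0.
- rewrite kill_lateX /kill_late.
  case: ifP => [|_]; last by rewrite subrr; apply: span0.
  case/existsP=> j /andP[lekj /eqP ->]; rewrite subr0.
  by apply: (@form_ideal_y _ x y); rewrite lekj ltn_ord.
- by rewrite rmorphD opprD addrACA; apply: spanD.
- have -> : p * q - rho k (p * q) = p * (q - rho k q) + rho k q * (p - rho k p).
    by rewrite rmorphM; ring.
  by apply: spanD; apply: spanMl.
Qed.

Lemma kill_late_y k j : (j < n)%N ->
  rho k (y j) = if (k <= j)%N then 0 else y j.
Proof. by move=> ltjn; rewrite kill_lateX /kill_late late_y. Qed.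

Lemma kill_late_x k i j : (i < m)%N -> (j < n)%N -> rho k (x i j) = x i j.
Proof. by move=> ltim ltjn; rewrite kill_lateX /kill_late late_x. Qed.

Lemma y_nonzerodivisor_row0 k p : (k < n)%N ->
  Q k.+1 0 (y k * p) -> Q k.+1 0 p.
Proof.
move=> ltkn /minor_ideal_lt -/(_ isT) Jyp.
have /eqP : rho k.+1 (y k * p) = 0.
  move: Jyp; move: (y k * p); apply: span_sub; first exact: ker_ideal.
  move=> s [[j /andP[ltkj ltjn] ->]|[i //]].
  by rewrite kill_late_y // ltkj.
rewrite rmorphM /= kill_late_y // ltnn mulf_eq0 (negPf (yentry_neq0 _)) /=.
move=> /eqP rp.
by have /form_ideal_sub_minor := kill_late_id k.+1 p; rewrite rp subr0.
Qed.

Section Elimination.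
Variables (c t : nat).
Hypotheses (ltcn : (c < n)%N) (letm : (t <= m)%N).

(** The values of the variables of column [c] that make the forms vanish.  The
    diagonal variable [vx c c] is solved last, since in the symmetric case the
    other entries of row [c] are themselves eliminated variables. *)
Definition solve_off_diag v : {fraction R} :=
  if [pick i : 'I_t | (i != c :> nat) && (v == vx i c)] is Some i
  then - tofrac (form c i) / tofrac (y c) else tofrac ('X_v : R).

Definition solve v : {fraction R} :=
  if late c.+1 v then 0 else
  if (c < t)%N && (v == vx c c)
  then - (\sum_(l < c) solve_off_diag (vx c l) * tofrac (y l)) / tofrac (y c)
  else solve_off_diag v.

Definition phi := mmap (@tofrac R \o @mpolyC N K) solve.
HB.instance Definition _ := GRing.RMorphism.on phi.

Lemma phiX v : phi 'X_v = solve v.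
Proof. by rewrite /phi mmapX mmap1U. Qed.

Lemma phiC a : phi a%:MP = tofrac a%:MP.
Proof. by rewrite /phi mmapC. Qed.

Lemma row_lt i : (i < t)%N -> (i < m)%N.
Proof. by move=> ltit; apply: leq_trans letm. Qed.

Lemma phi_y l : (l <= c)%N -> phi (y l) = tofrac (y l).
Proof.
move=> lelc; have ltln := leq_ltn_trans lelc ltcn.
rewrite phiX /solve late_y // ltnNge lelc /=.
case: ifP => [/andP[/row_lt ltcm]|_].
  by rewrite eq_sym (negPf (vx_neq_vy _ _ _)).
rewrite /solve_off_diag; case: pickP => // i /andP[_].
by rewrite eq_sym (negPf (vx_neq_vy (row_lt (ltn_ord i)) ltcn ltln)).
Qed.

Lemma phi_yc_neq0 : phi (y c) != 0.
Proof. by rewrite phi_y // tofrac_eq0 yentry_neq0. Qed.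

Lemma phi_y_late j : (c < j < n)%N -> phi (y j) = 0.
Proof. by case/andP=> ltcj ltjn; rewrite phiX /solve late_y // ltcj. Qed.

Lemma phi_form i : (i < t)%N -> phi (form n i) = 0.
Proof.
move=> ltit; have ltim := row_lt ltit.
have /eqP : phi (form n i - form c.+1 i) = 0.
  move: (row_form_trunc x y 0 i ltcn); move: (_ - _).
  apply: span_sub; first exact: ker_ideal.
  by move=> s [[j jP ->]|[//]]; apply: phi_y_late.
rewrite rmorphB subr_eq0 => /eqP ->.
rewrite /row_form big_ord_recr rmorphD rmorphM rmorph_sum /= phi_y //.
have yc0 : tofrac (y c) != 0 by rewrite tofrac_eq0 yentry_neq0.
apply/eqP; rewrite addr_eq0 -eqr_oppLR -(can2_eq (mulfVK yc0) (mulfK yc0)).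
apply/eqP; rewrite phiX /solve late_x //; have [eic|neic] := eqVneq i c.
  rewrite eic in ltit ltim *; rewrite ltit eqxx /=; congr (- _ / _).
  apply: eq_bigr => l _; rewrite rmorphM /= phi_y 1?ltnW //; congr (_ * _).
  have ltln : (l < n)%N by apply: ltn_trans ltcn.
  by rewrite phiX /solve late_x // (negPf (vx_neq_diag _ _ _)) ?andbF.
have -> /= : ((c < t) && (vx i c == vx c c))%N = false.
  apply/andP=> -[/row_lt ltcm /eqP/(vx_col_inj ltim ltcm ltcn)/eqP].
  by rewrite (negPf neic).
rewrite /solve_off_diag; case: pickP => [i' /andP[nei'c /eqP evi']|].
  rewrite -(vx_col_inj ltim (row_lt (ltn_ord i')) ltcn evi').
  rewrite rmorph_sum; congr (- _ / _); apply: eq_bigr => l _.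
  have neq_col i1 : (i1 < t)%N -> (vx i l == vx i1 c) = false.
    by move=> /row_lt lti1m; apply/negbTE/vx_neq_col.
  have ltln : (l < n)%N by apply: ltn_trans ltcn.
  rewrite !rmorphM /= phi_y 1?ltnW //; congr (_ * _).
  rewrite phiX /solve late_x //; case: ifP => [/andP[ltct]|_].
    by rewrite neq_col.
  by rewrite /solve_off_diag; case: pickP => // i1; rewrite neq_col ?andbF.
by move/(_ (Ordinal ltit)); rewrite /= neic eqxx.
Qed.

(** Modulo the form ideal, a power of y_c times an eliminated variable is a
    polynomial in the other variables; so a power of y_c clears the denominators
    of [phi r] compatibly with the ideal.  This makes the kernel
    of [phi] no larger than the saturation. *)
Lemma scale_phi r : exists e q, J c.+1 t (y c ^+ e * r - q) /\
  tofrac (y c ^+ e) * phi r = tofrac q.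
Proof.
pose good p := exists e q, J c.+1 t (y c ^+ e * p - q) /\
  tofrac (y c ^+ e) * phi p = tofrac q.
have good_refl q : phi q = tofrac q -> good q.
  by move=> phiq; exists 0, q; rewrite expr0 tofrac1 !mul1r subrr; split=> //;
    apply: span0.
have good0 q : J c.+1 t q -> phi q = 0 -> good q.
  by move=> Jq phiq; exists 0, 0; rewrite expr0 tofrac1 !mul1r subr0 tofrac0.
have goodD p q : good p -> good q -> good (p + q).
  move=> [e [p' [Jp phip]]] [d [q' [Jq phiq]]].
  exists (e + d), (y c ^+ d * p' + y c ^+ e * q'); split.
    have -> : y c ^+ (e + d) * (p + q) - (y c ^+ d * p' + y c ^+ e * q') =
      y c ^+ d * (y c ^+ e * p - p') + y c ^+ e * (y c ^+ d * q - q').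
      by rewrite exprD; ring.
    by apply: spanD; apply: spanMl.
  by rewrite rmorphD tofracD !tofracM -phip -phiq exprD tofracM; ring.
have goodM p q : good p -> good q -> good (p * q).
  move=> [e [p' [Jp phip]]] [d [q' [Jq phiq]]].
  exists (e + d), (p' * q'); split.
    have -> : y c ^+ (e + d) * (p * q) - p' * q' =
      y c ^+ d * q * (y c ^+ e * p - p') + p' * (y c ^+ d * q - q').
      by rewrite exprD; ring.
    by apply: spanD; apply: spanMl.
  by rewrite rmorphM tofracM -phip -phiq exprD tofracM; ring.
have good_div p q : J c.+1 t (y c * p - q) ->
    tofrac (y c) * phi p = phi q -> good q -> good p.
  move=> Jpq phipq [e [q' [Jq phiq]]]; exists e.+1, q'; split.
    have -> : y c ^+ e.+1 * p - q' =
      y c ^+ e * (y c * p - q) + (y c ^+ e * q - q').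
      by rewrite exprSr; ring.
    by apply: spanD => //; apply: spanMl.
  by rewrite -phiq -phipq exprSr tofracM mulrA.
have yc0 : tofrac (y c) != 0 by rewrite tofrac_eq0 yentry_neq0.
have goodC a : good a%:MP by apply: good_refl; apply: phiC.
have good_y l : (l <= c)%N -> good (y l).
  by move=> lelc; apply: good_refl; apply: phi_y.
have J_solve i : (i < t)%N -> J c.+1 t (y c * x i c - - form c i).
  move=> ltit; have := form_ideal_trunc x y ltcn ltit.
  by rewrite /row_form big_ord_recr opprK addrC [_ * y c]mulrC.
have good_off v : late c.+1 v = false ->
    (c < t)%N && (v == vx c c) = false -> good 'X_v.
  move=> nlate ndiag.
  have : phi 'X_v = solve_off_diag v by rewrite phiX /solve nlate ndiag.
  rewrite /solve_off_diag; case: pickP => [i /andP[_ /eqP ->]|_]; last first.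
    exact: good_refl.
  move=> phiv; exists 1, (- form c i); rewrite expr1.
  split; first exact: J_solve.
  by rewrite phiv mulrC mulfVK // tofracN.
rewrite -/(good r); elim/mpoly_var_ind: r => // v.
have [/existsP[j /andP[ltcj /eqP ->]]|nlate] := boolP (late c.+1 v).
  by apply: good0; [apply: form_ideal_y | apply: phi_y_late];
    rewrite ltcj ltn_ord.
have [/andP[ltct /eqP ev]|/negPf ndiag] :=
  boolP ((c < t) && (v == vx c c))%N; last first.
  by apply: good_off => //; apply: negbTE.
apply: (good_div _ (- form c c)).
- by rewrite ev; apply: J_solve.
- rewrite phiX /solve (negPf nlate) ltct ev eqxx /= mulrC mulfVK //.
  rewrite rmorphN rmorph_sum; congr (- _); apply: eq_bigr => l _.
  rewrite rmorphM /= phi_y 1?ltnW //; congr (_ * _).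
  have ltln : (l < n)%N by apply: ltn_trans ltcn.
  rewrite phiX /solve late_x ?row_lt // (negPf (vx_neq_diag _ _ _)) ?row_lt //.
  by rewrite andbF.
rewrite -mulN1r; apply: (goodM); first by rewrite -mpolyC1 -mpolyCN.
apply: big_ind => [||l _]; first exact: (goodC 0).
  exact: (goodD).
apply: goodM; last exact: good_y (ltnW _).
have ltln : (l < n)%N by apply: ltn_trans ltcn.
apply: good_off; first by rewrite late_x ?row_lt.
by rewrite (negPf (vx_neq_diag _ _ _)) ?row_lt ?andbF.
Qed.

Lemma phi_ker p : phi p = 0 -> exists e, J c.+1 t (y c ^+ e * p).
Proof.
have [e [q [Jp]]] := scale_phi p => + phip.
rewrite phip mulr0 => /esym/eqP; rewrite tofrac_eq0 => /eqP q0.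
by exists e; rewrite q0 subr0 in Jp.
Qed.

(** Evaluate at x_(t,c) = y_c = 1 and all other variables 0: the ideal
    vanishes, because column [c] has distinct variables, and the form gives
    1. *)
Lemma form_notin e : (t < m)%N -> ~ J c.+1 t (y c ^+ e * form n t).
Proof.
move=> lttm.
pose ev v : K := ((v == vx t c) || (v == vy c))%:R.
have evy j : (j < n)%N -> (y j).@[ev] = (j == c)%:R.
  move=> ltjn; rewrite mevalXU /ev eq_sym (negPf (vx_neq_vy _ _ _)) //=.
  by have -> : (vy j == vy c) = (j == c) by apply/eqP/eqP => [/vy_inj->|->].
have evform i : (i < m)%N -> (form n i).@[ev] = (i == t)%:R.
  move=> ltim; rewrite rmorph_sum (bigD1 (Ordinal ltcn)) //= big1 ?addr0.
    rewrite rmorphM /= evy // eqxx mulr1 mevalXU /ev.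
    rewrite (negPf (vx_neq_vy _ _ _)) // orbF.
    by have -> : (vx i c == vx t c) = (i == t)
      by apply/eqP/eqP => [/vx_col_inj->|->].
  move=> j /negPf; rewrite -val_eqE /= => neqj.
  by rewrite rmorphM /= evy // neqj mulr0.
have evJ p : J c.+1 t p -> p.@[ev] = 0.
  move: p; apply: span_sub; first exact: ker_ideal.
  move=> s [[j /andP[ltcj ltjn] ->]|[i ltit ->]].
    by rewrite evy // gtn_eqF.
  by rewrite evform ?row_lt // ltn_eqF.
move/evJ/eqP; rewrite rmorphM rmorphXn /= evy // evform // !eqxx expr1n mulr1.
by rewrite oner_eq0.
Qed.

Hypothesis y_reg : forall p, Q c.+1 t (y c * p) -> Q c.+1 t p.

Lemma minor_ideal_ker p : Q c.+1 t p <-> phi p = 0.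
Proof.
split; last first.
  case/phi_ker=> e /form_ideal_sub_minor.
  elim: e => [|e IHe]; first by rewrite mul1r.
  by rewrite exprS -mulrA => /y_reg/IHe.
move: p; apply: span_sub; first exact: ker_ideal.
have phiJ s : J c.+1 t s -> phi s = 0.
  move: s; apply: span_sub; first exact: ker_ideal.
  by move=> s [[j jP ->]|[i ltit ->]]; [apply: phi_y_late | apply: phi_form].
move=> s [Js|[f f_incr ->]]; first by apply/phiJ/span_gen.
apply: (mulIf phi_yc_neq0); rewrite mul0r -rmorphM.
by apply: phiJ; apply: minor_mul_y.
Qed.

Lemma form_nonzerodivisor_step p :
  (t < m)%N -> Q c.+1 t (form n t * p) -> Q c.+1 t p.
Proof.
move=> lttm /minor_ideal_ker/eqP; rewrite rmorphM mulf_eq0.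
case/orP=> /eqP; last by move/minor_ideal_ker.
by case/phi_ker=> e /form_notin.
Qed.

End Elimination.

Lemma kill_late0_y j : (j < n)%N -> rho 0 (y j) = 0.
Proof. by move=> ltjn; rewrite kill_late_y. Qed.

(** The outer induction alternates between the two kinds of nonzerodivisors: y
    for [k] columns gives the forms for [k] columns, which give y for the next
    column. *)
Lemma y_nonzerodivisor k t p : (k < n)%N -> (t <= m)%N ->
  Q k.+1 t (y k * p) -> Q k.+1 t p.
Proof.
elim: k t p => [|k IHk]; elim=> [|t IHt] p ltkn lttm;
  try exact: y_nonzerodivisor_row0;
  apply: (y_nonzerodivisor_rowS kill_late0_y (@kill_late_x 0) (@kill_late_id 0)
    ltkn lttm).
- by move=> q _; apply: minor_ideal0.
- by move=> q; apply: IHt => //; apply: ltnW.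
- move=> q; apply: form_nonzerodivisor_step => //;
    [exact: ltnW | exact: ltnW |].
  by move=> r; apply: IHk; apply: ltnW.
- by move=> q; apply: IHt => //; apply: ltnW.
Qed.

Lemma form_nonzerodivisor k t p : (0 < k <= n)%N -> (t < m)%N ->
  Q k t (form n t * p) -> Q k t p.
Proof.
case: k => // k ltkn lttm.
apply: form_nonzerodivisor_step => //; first exact: ltnW.
by move=> q; apply: y_nonzerodivisor => //; apply: ltnW.
Qed.

Lemma minor_ideal_prime k t (S : {pred R}) : (0 < k <= n)%N -> (t <= m)%N ->
  (forall p, p \in S <-> Q k t p) -> prime_ideal S.
Proof.
case: k => // k ltkn letm SQ.
apply: (@ker_prime_ideal _ _ (phi k t)) => p; rewrite SQ.
by apply: minor_ideal_ker => // q; apply: y_nonzerodivisor.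
Qed.

Lemma y_ideal_ker p : J 0 0 p <-> rho 0 p = 0.
Proof.
split=> [|rp]; first exact: (retract_form_ideal kill_late0_y).
by have := kill_late_id 0 p; rewrite rp subr0.
Qed.

Lemma y_ideal_prime (S : {pred R}) :
  (forall p, p \in S <-> J 0 0 p) -> prime_ideal S.
Proof.
move=> SP; apply: (@ker_prime_ideal _ _ (rho 0)) => p.
by rewrite SP y_ideal_ker.
Qed.

Lemma form_ideal_cap t p : (t <= m)%N -> J n t p <-> J 0 0 p /\ Q n t p.
Proof.
move=> letm; split=> [Jp|[/y_ideal_ker rp Qp]]; last first.
  exact: (minor_ideal_cap_y kill_late0_y (@kill_late_x 0) (@kill_late_id 0))
    Qp rp.
split; last exact: form_ideal_sub_minor.
by apply/y_ideal_ker; apply: (retract_form_ideal kill_late0_y) Jp.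
Qed.

Section Ideals.
Variables (A : 'M[R]_(m, n)) (Y : 'cV[R]_n).
Hypothesis A_x : forall i j, A i j = x i j.
Hypothesis Y_y : forall j, Y j 0 = y j.
Local Notation g := (entries (A *m Y)).

Lemma entriesE : g = mkseq (form n) m.
Proof.
rewrite /mkseq -val_enum_ord -map_comp; apply: eq_map => i /=.
by rewrite mxE; apply: eq_bigr => j _; rewrite A_x Y_y.
Qed.

Lemma mem_take_entries t p : (t <= m)%N ->
  p \in ideal_gen (take t g) <-> J n t p.
Proof.
move=> letm; rewrite -(rwP (ideal_genE _ _)).
rewrite entriesE -map_take take_iota (minn_idPl letm).
split; apply: span_mono => s.
  case/mapP=> i; rewrite mem_iota => /andP[_ ltit] ->.
  exact: form_ideal_form.
case=> [[j]|[i ltit ->]]; first by rewrite leqNgt andNb.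
by apply/span_gen/map_f; rewrite mem_iota.
Qed.

Lemma mem_entries p : p \in ideal_gen g <-> J n m p.
Proof.
by rewrite -(mem_take_entries _ (leqnn m)) take_oversize // entriesE size_mkseq.
Qed.

Lemma mem_ycol p : p \in ideal_gen (entries Y) <-> J 0 0 p.
Proof.
rewrite -(rwP (ideal_genE _ _)); split; apply: span_mono => s.
  case/mapP=> j _ ->; rewrite Y_y.
  by apply: (@form_ideal_y _ x y); apply: ltn_ord.
case=> [[j /= ltjn ->]|[]//].
by apply/span_gen/mapP; exists (Ordinal ltjn); rewrite ?mem_enum ?Y_y.
Qed.

Lemma mem_minors (D : seq R) p :
  (forall d, d \in D -> exists2 f, increasing n m f & d = minor n f) ->
  (forall f, increasing n m f -> minor n f \in D) ->
  p \in ideal_gen (g ++ D) <-> Q n m p.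
Proof.
move=> D_minor minor_D; rewrite -(rwP (ideal_genE _ _)).
split; apply: span_mono => s.
  rewrite mem_cat => /orP[sg|/D_minor sD]; last by apply: span_gen; right.
  by apply/form_ideal_sub_minor/mem_entries/ideal_genE/span_gen.
case=> [Js|[f /minor_D fD ->]]; last first.
  by apply: span_gen; rewrite mem_cat fD orbT.
have /mem_entries/ideal_genE : J n m s by apply: span_gen.
by apply: span_mono => q qg; apply: span_gen; rewrite mem_cat qg.
Qed.

Hypothesis n_gt0 : (0 < n)%N.

Lemma entries_decomposition (D : seq R) :
  (forall d, d \in D -> exists2 f, increasing n m f & d = minor n f) ->
  (forall f, increasing n m f -> minor n f \in D) ->
  let P := ideal_gen (entries Y) in
  let Q := ideal_gen (g ++ D) in
  [/\ ideal_gen g =i [predI P & Q], primary_ideal P & primary_ideal Q].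
Proof.
move=> D_minor minor_D; split.
- move=> p; rewrite inE; apply/idP/andP => [/mem_entries|[]].
    case/form_ideal_cap => // Pp Qp; split; first exact/mem_ycol.
    exact/mem_minors.
  move=> /mem_ycol Pp /(mem_minors _ D_minor minor_D) Qp.
  exact/mem_entries/form_ideal_cap.
- exact/prime_ideal_primary/y_ideal_prime/mem_ycol.
apply/prime_ideal_primary/(@minor_ideal_prime n m) => // [|p].
  by rewrite n_gt0 leqnn.
exact: mem_minors.
Qed.

Hypothesis le_mn : (m <= n)%N.

Lemma mem_take_entries_lt t p : (t < m)%N ->
  p \in ideal_gen (take t g) <-> Q n t p.
Proof.
move=> lttm; rewrite (mem_take_entries _ (ltnW lttm)).
split; first exact: form_ideal_sub_minor.
by apply: minor_ideal_lt; apply: leq_trans le_mn.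
Qed.

Lemma entries_regular : regular_sequence g.
Proof.
have sg : size g = m by rewrite entriesE size_mkseq.
split=> [i|]; rewrite ?sg.
  move=> ltim p; rewrite !mem_take_entries_lt // {1}entriesE nth_mkseq //.
  by apply: form_nonzerodivisor; rewrite ?n_gt0 ?leqnn.
apply/negP=> /mem_entries/(retract_form_ideal kill_late0_y)/eqP.
by rewrite rmorph1 oner_eq0.
Qed.

Lemma take_entries_prime t : (0 < t < m)%N ->
  prime_ideal (ideal_gen (take t g)).
Proof.
case/andP=> _ lttm; apply: (@minor_ideal_prime n t);
  rewrite ?n_gt0 ?leqnn 1?ltnW //.
by move=> p; apply: mem_take_entries_lt.
Qed.

End Ideals.

End GenericPolynomials.

(** * Generic and generic symmetric matrices *)

Section IndeterminateMatrix.
Variables (K : fieldType) (I : finType) (m n : nat).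
Variable e : 'I_m.+1 -> 'I_n.+1 -> I.
Hypothesis e_col_inj : forall c, injective (e^~ c).
Hypothesis e_neq_col : forall (i i' : 'I_m.+1) (l c : 'I_n.+1),
  (l < c)%N -> i != c :> nat -> e i l != e i' c.
Hypothesis e_neq_diag : forall (i : 'I_m.+1) (l c : 'I_n.+1),
  (l < c)%N -> i = c :> nat -> e i l != e i c.

(** Indices beyond the size of the matrix are sent to arbitrary ones by [inord];
    the polynomial part only looks at indices within bounds. *)
Definition xindex i j := enum_rank (inl (e (inord i) (inord j)) : I + 'I_n.+1).
Definition yindex j := enum_rank (inr (inord j) : I + 'I_n.+1).

Lemma yindex_inj j l : (j < n.+1)%N -> (l < n.+1)%N ->
  yindex j = yindex l -> j = l.
Proof.
by move=> ltj ltl /enum_rank_inj[/(congr1 val)]; rewrite /= !inordK.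
Qed.

Lemma xindex_neq_y i j l : (i < m.+1)%N -> (j < n.+1)%N -> (l < n.+1)%N ->
  xindex i j != yindex l.
Proof. by move=> _ _ _; rewrite (inj_eq enum_rank_inj). Qed.

Lemma xindex_col_inj i i' c : (i < m.+1)%N -> (i' < m.+1)%N -> (c < n.+1)%N ->
  xindex i c = xindex i' c -> i = i'.
Proof.
move=> lti lti' _ /enum_rank_inj[/e_col_inj/(congr1 val)].
by rewrite /= !inordK.
Qed.

Lemma xindex_neq_col i i' l c : (i < m.+1)%N -> (i' < m.+1)%N -> (c < n.+1)%N ->
  (l < c)%N -> i != c -> xindex i l != xindex i' c.
Proof.
move=> lti _ ltc ltlc neic; rewrite (inj_eq enum_rank_inj).
by apply: (@e_neq_col _ (inord i') (inord l) (inord c));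
  rewrite !inordK // (ltn_trans ltlc).
Qed.

Lemma xindex_neq_diag l c : (c < m.+1)%N -> (c < n.+1)%N -> (l < c)%N ->
  xindex c l != xindex c c.
Proof.
move=> ltcm ltcn ltlc; rewrite (inj_eq enum_rank_inj).
by apply: (@e_neq_diag (inord c) (inord l) (inord c));
  rewrite !inordK // (ltn_trans ltlc).
Qed.

Variable X : 'M[xyring K I n.+1]_(m.+1, n.+1).
Hypothesis X_xvar : forall i j, X i j = xvar K n.+1 (e i j).

Lemma X_xentry i j : X i j = xentry K xindex i j.
Proof. by rewrite X_xvar /xentry /xindex !inord_val. Qed.

Lemma ycol_yentry j : ycol K I n.+1 j 0 = yentry K yindex j.
Proof. by rewrite mxE /yentry /yindex inord_val. Qed.

Local Notation Y := (ycol K I n.+1).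
Local Notation g := (entries (X *m Y)).

Lemma regular_and_prime : (m <= n)%N ->
  regular_sequence g /\
  forall t, (0 < t < m.+1)%N -> prime_ideal (ideal_gen (take t g)).
Proof.
move=> lemn; split.
  by apply: (entries_regular yindex_inj xindex_neq_y xindex_col_inj
    xindex_neq_col xindex_neq_diag X_xentry ycol_yentry).
by move=> t; apply: (take_entries_prime yindex_inj xindex_neq_y xindex_col_inj
    xindex_neq_col xindex_neq_diag X_xentry ycol_yentry).
Qed.

Lemma primary_decomposition (D : seq (xyring K I n.+1)) :
  let minor f := \det (\matrix_(a < n.+1, j < n.+1) X (inord (f a)) j) in
  (forall d, d \in D -> exists2 f, increasing n.+1 m.+1 f & d = minor f) ->
  (forall f, increasing n.+1 m.+1 f -> minor f \in D) ->
  let P := ideal_gen (entries Y) in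
  let Q := ideal_gen (g ++ D) in
  [/\ ideal_gen g =i [predI P & Q], primary_ideal P & primary_ideal Q].
Proof.
move=> minor D_minor minor_D.
have minorE f : increasing n.+1 m.+1 f ->
    minor f = row_minor (xentry K xindex) n.+1 f.
  move=> [_ f_lt]; congr (\det _); apply/matrixP=> a j.
  by rewrite !mxE X_xentry inordK ?f_lt.
apply: (entries_decomposition yindex_inj xindex_neq_y xindex_col_inj
    xindex_neq_col xindex_neq_diag X_xentry ycol_yentry) => //.
- by move=> d /D_minor[f f_incr ->]; exists f; rewrite ?minorE.
- by move=> f f_incr; rewrite -minorE ?minor_D.
Qed.

End IndeterminateMatrix.

Lemma square_case (K : fieldType) (I : finType) (n : nat)
    (e : 'I_n.+1 -> 'I_n.+1 -> I) (X : 'M[xyring K I n.+1]_n.+1) :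
  (forall c, injective (e^~ c)) ->
  (forall i i' l c : 'I_n.+1, (l < c)%N -> i != c :> nat -> e i l != e i' c) ->
  (forall i l c : 'I_n.+1, (l < c)%N -> i = c :> nat -> e i l != e i c) ->
  (forall i j, X i j = xvar K n.+1 (e i j)) ->
  let Y := ycol K I n.+1 in
  let g := entries (X *m Y) in
  let P := ideal_gen (entries Y) in
  let Q := ideal_gen (rcons g (\det X)) in
  [/\ regular_sequence g,
      forall t : nat, (0 < t < n.+1)%N -> prime_ideal (ideal_gen (take t g))
    & [/\ ideal_gen g =i [predI P & Q], primary_ideal P & primary_ideal Q]].
Proof.
move=> e_inj e_col e_diag X_e Y g P Q.
have [g_reg g_prime] := regular_and_prime e_inj e_col e_diag X_e (leqnn n).
have det_minor f : increasing n.+1 n.+1 f ->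
    \det (\matrix_(a < n.+1, j < n.+1) X (inord (f a)) j) = \det X.
  move=> f_incr; congr (\det _); apply/matrixP=> a j.
  by rewrite mxE (increasing_id f_incr) ?inord_val.
split=> //; rewrite /Q -cats1.
apply: (primary_decomposition e_inj e_col e_diag X_e) => [d|f /det_minor ->].
  have id_incr : increasing n.+1 n.+1 id by split=> [a b /andP[]|].
  by rewrite inE => /eqP ->; exists id => //; apply/esym/(det_minor id).
by rewrite inE.
Qed.

Lemma pair_neq_col (m n : nat) (i i' : 'I_m) (l c : 'I_n) :
  (l < c)%N -> (i, l) != (i', c) :> gen_index m n.
Proof. by move=> ltlc; apply/eqP => -[_ elc]; rewrite elc ltnn in ltlc. Qed.

Lemma sort_pair_inj (n : nat) (c : 'I_n) : injective (fun i => sort_pair i c).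
Proof.
by move=> i i'; rewrite /sort_pair; case: ifP => _; case: ifP => _ [];
  congruence.
Qed.

Lemma sort_pair_eq (n : nat) (i l i' c : 'I_n) :
  sort_pair i l = sort_pair i' c -> i = c \/ l = c.
Proof.
by rewrite /sort_pair; case: ifP => _; case: ifP => _ [];
  do ?[by left | by right | move=> ->].
Qed.

Theorem theorem1p1 (K : fieldType) (n : nat) (n_gt0 : (0 < n)%N) :
  [/\ let X := gen_mx K n n in
      let Y := ycol K (gen_index n n) n in
      let g := entries (X *m Y) in
      let P := ideal_gen (entries Y) in
      let Q := ideal_gen (rcons g (\det X)) in
      [/\ regular_sequence g,
          forall t : nat, (0 < t < n)%N -> prime_ideal (ideal_gen (take t g))
        & [/\ ideal_gen g =i [predI P & Q], primary_ideal P & primary_ideal Q]],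
      let X := sym_mx K n in
      let Y := ycol K (sym_index n) n in
      let g := entries (X *m Y) in
      let P := ideal_gen (entries Y) in
      let Q := ideal_gen (rcons g (\det X)) in
      [/\ regular_sequence g,
          forall t : nat, (0 < t < n)%N -> prime_ideal (ideal_gen (take t g))
        & [/\ ideal_gen g =i [predI P & Q], primary_ideal P & primary_ideal Q]]
    & let X := gen_mx K n.+1 n in
      let Y := ycol K (gen_index n.+1 n) n in
      let g := entries (X *m Y) in
      let P := ideal_gen (entries Y) in
      let Q := ideal_gen (g ++ [seq \det (row' i X) | i : 'I_n.+1]) in
      [/\ ideal_gen g =i [predI P & Q], primary_ideal P & primary_ideal Q]].
Proof.
case: n n_gt0 => // n _.
have gen_inj m (c : 'I_n.+1) :
    injective (fun i => (i, c) : gen_index m.+1 n.+1) by move=> i i' [].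
split.
- apply: (square_case (e := fun i j => (i, j) : gen_index n.+1 n.+1)) => //.
  + by move=> i i' l c ltlc _; apply: pair_neq_col.
  + by move=> i l c ltlc _; apply: pair_neq_col.
  + by move=> i j; rewrite mxE.
- apply: (square_case (e := fun i j =>
    exist _ (sort_pair i j) (sort_pairP i j) : sym_index n.+1)).
  + by move=> c i i' /(congr1 val)/sort_pair_inj.
  + move=> i i' l c ltlc neic; apply/eqP => /(congr1 val)/sort_pair_eq[ec|ec].
      by rewrite ec eqxx in neic.
    by rewrite ec ltnn in ltlc.
  + move=> i l c ltlc /val_inj eic; apply/eqP => /(congr1 val) /=.
    rewrite eic /sort_pair leqnn leqNgt ltlc /= => -[elc].
    by rewrite elc ltnn in ltlc.
  + by move=> i j; rewrite mxE.
apply: (primary_decomposition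
  (e := fun i j => (i, j) : gen_index n.+2 n.+1)) => //.
- by move=> i i' l c ltlc _; apply: pair_neq_col.
- by move=> i l c ltlc _; apply: pair_neq_col.
- by move=> i j; rewrite mxE.
- move=> d /mapP[i _ ->]; exists (bump i); first exact: bump_increasing.
  congr (\det _); apply/matrixP=> a j; rewrite mxE [RHS]mxE.
  congr (gen_mx _ _ _ _ _); apply/val_inj; rewrite /= inordK //.
  exact: ltn_ord (lift i a).
move=> f f_incr; have [i fi] := increasing_bump f_incr.
apply/mapP; exists i; first by rewrite mem_enum.
congr (\det _); apply/matrixP=> a j; rewrite mxE [RHS]mxE fi //.
congr (gen_mx _ _ _ _ _); apply/val_inj; rewrite /= inordK //.
exact: ltn_ord (lift i a).
Qed.
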